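(* Let $p>1$. Let $\mathcal{H}_p$ be a generalized $p$-Laplacian operator defined on the graph $\mathcal{G}=(V,E)$ and let $\mathcal{G}'$ be the graph obtained from $\mathcal{G}$ by deleting the $n$ nodes $u_1,u_2,\dots,u_n$ (and all edges incident to them). Consider the generalized $p$-Laplacian operator on $\mathcal{G}'$ defined as $$(\mathcal{H}_p'f)(u):=\sum_{v\in V'}\omega'_{uv}\phi_p(f(u)-f(v))+\kappa'_u\phi_p(f(u)),$$ where $V'=V\setminus\{u_1,\dots,u_n\}$, $\omega'_{uv}=\omega_{uv}$ and $\kappa'_u=\kappa_u+\sum_{i=1}^n\omega_{uu_i}$. Let $\{\lambda_k\}$ denote the variational eigenvalues of $\mathcal{H}_p$ and $\{\eta_k\}$ those of $\mathcal{H}_p'$. Then $$\lambda_k\le\eta_k\le\lambda_{k+n}$$ for any $k\in\{1,\dots,|V|-n\}$.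
   Context: Let $\mathcal{G}=(V,E)$ be a finite undirected simple graph with $N=|V|$ nodes, positive node weights $\varrho:V\to\mathbb{R}_+$ and positive symmetric edge weights $\omega:E\to\mathbb{R}_+$, with $\omega_{uv}=0$ if $uv\notin E$; $v\sim u$ means that $uv\in E$. For $p>1$ put $\phi_p(x)=|x|^{p-2}x$ (with $\phi_p(0)=0$). Given real coefficients $\kappa_u$, $u\in V$, the generalized $p$-Laplacian is $(\mathcal{H}_p f)(u)=\sum_{v\sim u}\omega_{uv}\phi_p(f(u)-f(v))+\kappa_u\phi_p(f(u))$ for $f:V\to\mathbb{R}$. Node weights on $\mathcal{G}'$ are the restriction of $\varrho$ to $V'$. Krasnoselskii genus: for a closed symmetric set $A=-A$ in $\mathbb{R}^N$, $\gamma(A)$ is the least $k\in\mathbb{N}$ such that there is a continuous odd map $\varphi:A\to\mathbb{R}^k$ with $0\notin\varphi(A)$; $\gamma(A)=\infty$ if no such $k$ exists and $\gamma(\emptyset)=0$. Let $\mathcal{S}_p=\{f:V\to\mathbb{R}:\|f\|_p=1\}$, $\mathcal{F}_k(\mathcal{S}_p)=\{A\subseteq\mathcal{S}_p: A=-A \text{ closed},\ \gamma(A)\ge k\}$, and $$\mathcal{R}_{\mathcal{H}_p}(f)=\frac{\sum_{uv\in E}\omega_{uv}|f(u)-f(v)|^p+\sum_{u\in V}\kappa_u|f(u)|^p}{\sum_{u\in V}\varrho_u|f(u)|^p}.$$ The variational eigenvalues are $\lambda_k=\min_{A\in\mathcal{F}_k(\mathcal{S}_p)}\max_{f\in A}\mathcal{R}_{\mathcal{H}_p}(f)$,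 $k=1,\dots,N$. The variational eigenvalues $\eta_k$ of $\mathcal{H}_p'$, $k=1,\dots,N-n$, are defined in the same way on $\mathcal{G}'$ with weights $\omega',\kappa',\varrho|_{V'}$. *)

(* Defs.v *)
From HB Require Import structures.
From mathcomp Require Import all_boot all_order all_algebra.
From mathcomp Require Import all_classical all_reals all_analysis.

Set Implicit Arguments.
Unset Strict Implicit.
Unset Printing Implicit Defensive.

Import Order.TTheory GRing.Theory Num.Theory.
Import numFieldNormedType.Exports.

Local Open Scope classical_set_scope.
Local Open Scope ring_scope.

(* The data defining a generalized p-Laplacian: a finite simple graph on V,
   node weights, symmetric edge weights supported exactly on the edges, and
   real coefficients kappa. The exponent p is kept separate. *)
Record pLaplacian (R : realType) (V : finType) := PLaplacian {
  adj : rel V;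
  adj_sym : symmetric adj;
  adj_irr : irreflexive adj;
  node_weight : V -> R;
  node_weight_gt0 : forall u, 0 < node_weight u;
  edge_weight : V -> V -> R;
  edge_weight_sym : forall u v, edge_weight u v = edge_weight v u;
  edge_weight_gt0 : forall u v, adj u v -> 0 < edge_weight u v;
  edge_weight_eq0 : forall u v, ~~ adj u v -> edge_weight u v = 0;
  kappa : V -> R
}.

Section Operator.
Context {R : realType} {V : finType}.
Implicit Types (p : R) (H : pLaplacian R V) (f : V -> R).

Definition phi p (x : R) : R := `|x| `^ (p - 2) * x.

Definition Hp p H f (u : V) : R :=
  \sum_(v | adj H u v) edge_weight H u v * phi p (f u - f v)
  + kappa H u * phi p (f u).

(* Each undirected edge occurs twice in the double sum, hence the 1/2. *)
Definition energy p H f : R :=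
  2^-1 * (\sum_u \sum_(v | adj H u v)
            edge_weight H u v * `|f u - f v| `^ p)
  + \sum_u kappa H u * `|f u| `^ p.

Definition rayleigh p H f : R :=
  energy p H f / \sum_u node_weight H u * `|f u| `^ p.

Lemma phi_mulr p (x : R) : 1 < p -> phi p x * x = `|x| `^ p.
Proof.
move=> p1; rewrite /phi -mulrA -expr2 -real_normK ?num_real//.
have [->|x0] := eqVneq x 0.
  by rewrite normr0 expr0n mulr0 powR0// gt_eqF// (lt_trans ltr01).
rewrite -powR_mulrn// -powRD; first by rewrite subrK.
by rewrite normr_eq0 x0 implybT.
Qed.

Lemma phiN p (x : R) : phi p (- x) = - phi p x.
Proof. by rewrite /phi normrN mulrN. Qed.

Lemma energyE p H f : 1 < p -> energy p H f = \sum_u f u * Hp p H f u.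
Proof.
move=> p1; rewrite /energy /Hp.
under [RHS]eq_bigr do rewrite mulrDr.
rewrite big_split/=; congr (_ + _); last first.
  by apply: eq_bigr => u _; rewrite mulrCA [_ * phi _ _]mulrC phi_mulr.
set T := (X in _ = X).
have TE : T = \sum_u \sum_(v | adj H u v)
    edge_weight H u v * (phi p (f u - f v) * f u).
  apply: eq_bigr => u _; rewrite mulr_sumr; apply: eq_bigr => v _.
  by rewrite mulrCA [f u * _]mulrC.
have TN : T = \sum_u \sum_(v | adj H u v)
    edge_weight H u v * (phi p (f u - f v) * - f v).
  rewrite TE (exchange_big_dep predT)//=; apply: eq_bigr => u _.
  apply: eq_big => [v|v _]; first by rewrite adj_sym.
  by rewrite edge_weight_sym -(opprB (f u)) phiN mulNr -mulrN.
have TT : T + T = \sum_u \sum_(v | adj H u v)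
    edge_weight H u v * `|f u - f v| `^ p.
  rewrite [X in X + _]TE TN -big_split/=; apply: eq_bigr => u _.
  rewrite -big_split/=; apply: eq_bigr => v _.
  by rewrite -mulrDr -mulrDr phi_mulr.
by rewrite -TT -mulr2n -[T *+ 2]mulr_natl mulKf.
Qed.

(* Deletion of the nodes us: the remaining nodes form the subtype
   {v | v \notin us}, and the weights of the removed edges are moved to the
   coefficients kappa. *)
Definition delete_nodes H n (us : n.-tuple V) :
    pLaplacian R {v : V | v \notin us}.
Proof.
refine {|
  adj := fun u v => adj H (val u) (val v);
  node_weight := fun u => node_weight H (val u);
  edge_weight := fun u v => edge_weight H (val u) (val v);
  kappa := fun u =>
    kappa H (val u) + \sum_(i < n) edge_weight H (val u) (tnth us i) |}.
- by move=> u v; exact: adj_sym.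
- by move=> u; exact: adj_irr.
- by move=> u; exact: node_weight_gt0.
- by move=> u v; exact: edge_weight_sym.
- by move=> u v; exact: edge_weight_gt0.
- by move=> u v; exact: edge_weight_eq0.
Defined.

End Operator.

Lemma Hp_delete_nodesE (R : realType) (V : finType) (p : R)
    (H : pLaplacian R V) n (us : n.-tuple V)
    (f : {v : V | v \notin us} -> R) (u : {v : V | v \notin us}) :
  Hp p (delete_nodes H us) f u =
  \sum_v edge_weight H (val u) (val v) * phi p (f u - f v)
  + (kappa H (val u) + \sum_(i < n) edge_weight H (val u) (tnth us i))
    * phi p (f u).
Proof.
congr (_ + _); rewrite big_mkcond; apply: eq_bigr => v _.
by case: ifPn => //= ?; rewrite edge_weight_eq0 ?mul0r.
Qed.

Section Variational.
Context {R : realType} {V : finType}.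
Implicit Types (p : R) (H : pLaplacian R V) (f : V -> R).

(* R^V carries the product topology. *)
Definition odd_on k (A : set {ptws V -> R}) (g : {ptws V -> R} -> 'rV[R]_k) :=
  forall f, A f -> g (\- f) = - g f.

Definition symmetric_set (A : set {ptws V -> R}) :=
  forall f, A f <-> A (\- f).

(* The infimum of a set of naturals in the extended reals: its least element
   if there is one and +oo otherwise. Only the empty set has a nowhere
   vanishing map to R^0, whence genus set0 = 0. *)
Definition genus (A : set {ptws V -> R}) : \bar R :=
  ereal_inf [set k%:R%:E | k in [set k : nat |
    exists g : {ptws V -> R} -> 'rV[R]_k,
      [/\ {within A, continuous g}, odd_on A g &
          forall f, A f -> g f != 0]]].

Definition pnorm p f : R := (\sum_u `|f u| `^ p) `^ p^-1.

Definition psphere p : set {ptws V -> R} := [set f | pnorm p f = 1].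

Definition genus_family p (k : nat) : set (set {ptws V -> R}) :=
  [set A | [/\ A `<=` psphere p, symmetric_set A, closed A &
               (k%:R%:E <= genus A)%E]].

(* For 1 <= k <= #|V| the supremum (of a continuous function over a nonempty
   compact set) and the infimum are attained, so this is the min-max value. *)
Definition variational_eigenvalue p H (k : nat) : \bar R :=
  ereal_inf [set ereal_sup [set (rayleigh p H f)%:E | f in A]
            | A in genus_family p k].

End Variational.

(* Main.v *)
Require Import Defs.
From mathcomp Require Import all_boot all_order all_algebra.
From mathcomp Require Import all_classical all_reals all_analysis.
From mathcomp Require Import ring.

Set Implicit Arguments.
Unset Strict Implicit.
Unset Printing Implicit Defensive.

Import Order.TTheory GRing.Theory Num.Theory.
Import numFieldNormedType.Exports.

Local Open Scope classical_set_scope.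
Local Open Scope ring_scope.

(** Let V' be the set of remaining nodes and E : R^V' -> R^V the extension by
zero, which identifies R^V' with the functions on V that vanish at the deleted
nodes. For f on V' the energy of E f equals the energy of f for the reduced
operator: an edge from u in V' to a deleted node contributes
[w |f u - 0|^p = w |f u|^p], exactly what the change of kappa adds
([energy_zero_ext]). The p-norms of f and E f, with or without node weights,
agree as well, so E is an odd isometric embedding of one p-sphere into the other
that preserves the Rayleigh quotients ([rayleigh_zero_ext]), and both
inequalities follow by transporting competitors of the min-max problems
along E.

Lower bound. If A' is a competitor for eta_k then E(A') is one for lambda_k
with the same Rayleigh quotients: it is closed, and its genus is at least that
of A' because odd maps on E(A') can be composed with E
([genus_family_zero_ext_image]).

Upper bound. If A is a competitor for lambda_(k+n) then its preimage
A' = E^-1(A), that is, the part of A vanishing at the deleted nodes, is a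
competitor for eta_k ([genus_family_zero_ext_preimage]). Passing to it lowers
the genus by at most n. Indeed, a nowhere vanishing odd map from A' to R^j
extends to a continuous odd map G on the whole of R^V', by the Tietze theorem
([odd_extension]); pairing G, evaluated at the restriction of f to V', with the
n values of f at the deleted nodes yields an odd map from A to R^(j+n). It has
no zero on A, since a function whose values at the deleted nodes are all zero
comes from A', where G does not vanish. Hence k + n <= j + n. The Rayleigh
quotients on A' are among those on A, so their supremum can only decrease. *)

(** * Continuity in products and matrices *)

(** A product of finitely many real lines is metrizable, hence normal; the
Tietze theorem needs this. *)
Lemma normal_ptws (R : realType) (V : finType) : normal_space {ptws V -> R}.
Proof. exact: (@pseudometric_normal R {ptws V -> R}). Qed.

Lemma continuous_ptws (X : topologicalType) (R : realType) (V : finType)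
    (f : X -> {ptws V -> R}) :
  (forall v, continuous (fun x => f x v)) -> continuous f.
Proof.
move=> cf x; apply/cvg_sup => v U [/= _ [[B oB <-] /= Bfx]] /filterS; apply.
by apply: (cf v x); exact: open_nbhs_nbhs.
Qed.

Lemma continuous_eval (R : realType) (V : finType) (v : V) :
  continuous (fun f : {ptws V -> R} => f v).
Proof. exact: (@proj_continuous V (fun=> R)). Qed.

Lemma continuous_mx (X : topologicalType) (R : realType) m n
    (f : X -> 'M[R]_(m, n)) :
  (forall i j, continuous (fun x => f x i j)) -> continuous f.
Proof.
move=> cf x; apply/filter_fromP => P Px.
apply: filter_forall => i; apply: filter_forall => j.
exact: (cf i j x _ (Px i j)).
Qed.

Lemma continuous_opp_ptws (R : realType) (V : finType) :
  continuous (fun f : {ptws V -> R} => (\- f : {ptws V -> R})).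
Proof.
apply: continuous_ptws => v f.
exact: (@continuousN R R^o _ _ _ (@continuous_eval R V v f)).
Qed.

Lemma within_continuous_comp_image (X Y Z : topologicalType) (A : set X)
    (f : X -> Y) (g : Y -> Z) :
  continuous f -> {within f @` A, continuous g} ->
  {within A, continuous (g \o f)}.
Proof.
move=> cf /subspace_continuousP cg; apply/subspace_continuousP => x Ax.
apply: cvg_comp (cg (f x) (imageP f Ax)) => U /(cf x) fxU.
rewrite /= /within/= nbhs_simpl.
by apply: (filterS _ (fxU : nbhs x _)) => y fU Ay; apply: fU; exists y.
Qed.

(** * Genus and extension of odd maps *)

Lemma genus_geP (R : realType) (V : finType) (A : set {ptws V -> R}) (k : nat) :
  (k%:R%:E <= genus A)%E <->
  forall j (g : {ptws V -> R} -> 'rV[R]_j), {within A, continuous g} ->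
    odd_on A g -> (forall f, A f -> g f != 0) -> (k <= j)%N.
Proof.
split=> [kA j g cg og g0|kA].
  have : (genus A <= (j%:R : R)%:E)%E.
    by apply: ereal_inf_lbound; exists j => //; exists g.
  by move=> /(le_trans kA); rewrite lee_fin ler_nat.
apply: le_ereal_inf_tmp => _ [j [g [cg og g0]] <-].
by rewrite lee_fin ler_nat (kA j g).
Qed.

(** An odd increasing bijection from R onto ]-1, 1[. Composing coordinates with
it makes them bounded, as the Tietze theorem requires, while keeping oddness
and the zero set. *)
Definition squash (R : realType) (t : R) : R := t / (1 + `|t|).

Lemma squash_den_gt0 (R : realType) (t : R) : 0 < 1 + `|t|.
Proof. by rewrite ltr_pwDl. Qed.

Lemma squashN (R : realType) (t : R) : squash (- t) = - squash t.
Proof. by rewrite /squash normrN mulNr. Qed.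

Lemma squash_eq0 (R : realType) (t : R) : (squash t == 0) = (t == 0).
Proof. by rewrite mulf_eq0 invr_eq0 (gt_eqF (squash_den_gt0 t)) orbF. Qed.

Lemma normr_squash_le1 (R : realType) (t : R) : `|squash t| <= 1.
Proof.
rewrite normrM normfV (gtr0_norm (squash_den_gt0 t)).
by rewrite ler_pdivrMr ?squash_den_gt0// mul1r lerDr.
Qed.

Lemma continuous_squash (R : realType) : continuous (@squash R).
Proof.
move=> t; apply: (@continuousM R R id (fun t => (1 + `|t|)^-1)).
  exact: cvg_id.
apply: continuousV; first by rewrite gt_eqF ?squash_den_gt0.
by apply: (@continuousD R R^o); [exact: cvg_cst|exact: norm_continuous].
Qed.

(** The extended map has values in the same R^j, but need not extend g itself:
each coordinate of g is squashed, extended to a function h by the Tietze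
theorem, and made odd as [h f - h (- f)]. On A this is twice the squashed
coordinate, so the map still has no zero there. *)
Lemma odd_extension (R : realType) (V : finType) (A : set {ptws V -> R}) j
    (g : {ptws V -> R} -> 'rV[R]_j) :
  closed A -> symmetric_set A -> {within A, continuous g} -> odd_on A g ->
  (forall f, A f -> g f != 0) ->
  exists G : {ptws V -> R} -> 'rV[R]_j,
    [/\ continuous G, forall f, G (\- f) = - G f & forall f, A f -> G f != 0].
Proof.
move=> clA sA cg og g0.
have ext (i : 'I_j) : exists h : {ptws V -> R} -> R,
    continuous h /\ forall f, A f -> h f = squash (g f ord0 i).
  have [] := @continuous_bounded_extension {ptws V -> R} R (@normal_ptws R V) A
    clA (fun f => squash (g f ord0 i)) 1 ltr01.
  - move=> f; apply: (@continuous_comp (subspace A) R R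
      (fun f => g f ord0 i) (@squash R)); last exact: continuous_squash.
    apply: (@continuous_comp (subspace A) 'rV[R]_j R g (fun M => M ord0 i)).
      exact: cg.
    exact: coord_continuous.
  - by move=> f _; exact: normr_squash_le1.
  - by move=> h [gh ch _]; exists h; split=> // f Af; rewrite gh ?inE.
have {ext}[h hP] : exists h : 'I_j -> {ptws V -> R} -> R, forall i,
    continuous (h i) /\ forall f, A f -> h i f = squash (g f ord0 i).
  by exists (fun i => projT1 (cid (ext i))) => i; case: (cid (ext i)).
exists (fun f => \row_i (h i f - h i (\- f))); split.
- apply: continuous_mx => a i f.
  under [X in continuous_at _ X]eq_fun do rewrite mxE.
  have ch : continuous (h i) by have [] := hP i.
  apply: (@continuousB R R^o _ (h i) (fun f => h i (\- f))); first exact: ch.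
  apply: (@continuous_comp {ptws V -> R} {ptws V -> R} R
    (fun f => (\- f : {ptws V -> R})) (h i)); last exact: ch.
  exact: continuous_opp_ptws.
- move=> f; apply/rowP => i; rewrite !mxE opprB; congr (_ - h i _).
  by apply/funext => v /=; rewrite opprK.
- move=> f Af; apply: contra (g0 f Af) => /eqP/rowP Gf0.
  apply/eqP/rowP => i; rewrite mxE; apply/eqP; rewrite -squash_eq0.
  have := Gf0 i; have [_ hA] := hP i.
  rewrite !mxE !hA//; last by rewrite -sA.
  rewrite og// mxE squashN opprK => /eqP.
  by rewrite -mulr2n mulrn_eq0.
Qed.

(** * Extension by zero at the deleted nodes *)

Definition zero_ext (R : realType) (V : finType) n (us : n.-tuple V)
    (f : {ptws {v : V | v \notin us} -> R}) : {ptws V -> R} :=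
  fun v => if insub v is Some u then f u else 0.

Definition restrict (R : realType) (V : finType) n (us : n.-tuple V)
    (f : {ptws V -> R}) : {ptws {v : V | v \notin us} -> R} :=
  fun u => f (val u).
Arguments restrict {R V n} us f.

Lemma zero_ext_val (R : realType) (V : finType) n (us : n.-tuple V)
    (f : {ptws {v : V | v \notin us} -> R}) (u : {v : V | v \notin us}) :
  zero_ext f (val u) = f u.
Proof. by rewrite /zero_ext valK. Qed.

Lemma zero_ext_deleted (R : realType) (V : finType) n (us : n.-tuple V)
    (f : {ptws {v : V | v \notin us} -> R}) i :
  zero_ext f (tnth us i) = 0.
Proof. by rewrite /zero_ext insubF// mem_tnth. Qed.

Lemma zero_extN (R : realType) (V : finType) n (us : n.-tuple V)
    (f : {ptws {v : V | v \notin us} -> R}) :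
  zero_ext (\- f) = \- zero_ext f.
Proof.
by apply/funext => v; rewrite /zero_ext /=; case: insub => //=; rewrite oppr0.
Qed.

Lemma zero_ext_restrict (R : realType) (V : finType) n (us : n.-tuple V)
    (f : {ptws V -> R}) :
  (forall i, f (tnth us i) = 0) -> zero_ext (restrict us f) = f.
Proof.
move=> f0; apply/funext => v; rewrite /zero_ext.
case: insubP => [u _ <- //|]; rewrite negbK => /tnthP[i ->].
by rewrite f0.
Qed.

Lemma restrict_zero_ext (R : realType) (V : finType) n (us : n.-tuple V)
    (f : {ptws {v : V | v \notin us} -> R}) :
  restrict us (zero_ext f) = f.
Proof. by apply/funext => u; exact: zero_ext_val. Qed.

Lemma continuous_zero_ext (R : realType) (V : finType) n (us : n.-tuple V) :
  continuous (@zero_ext R V n us).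
Proof.
apply: continuous_ptws => v; rewrite /zero_ext; case: insub => [u|].
  exact: continuous_eval.
exact: (@cst_continuous {ptws {v : V | v \notin us} -> R} R 0).
Qed.

Lemma continuous_restrict (R : realType) (V : finType) n (us : n.-tuple V) :
  continuous (@restrict R V n us).
Proof. by apply: continuous_ptws => u; exact: continuous_eval. Qed.

Definition values_at (R : realType) (V : finType) n (us : n.-tuple V)
    (f : {ptws V -> R}) : 'rV[R]_n := \row_i f (tnth us i).

Lemma continuous_values_at (R : realType) (V : finType) n (us : n.-tuple V) :
  continuous (@values_at R V n us).
Proof.
apply: continuous_mx => a i f; rewrite /values_at.
under [X in continuous_at _ X]eq_fun do rewrite mxE.
exact: continuous_eval.
Qed.

(** Both conditions on the right are closed, which makes extension by zero a
closed map. *)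
Lemma zero_ext_imageE (R : realType) (V : finType) n (us : n.-tuple V)
    (A : set {ptws {v : V | v \notin us} -> R}) :
  @zero_ext R V n us @` A =
  @restrict R V n us @^-1` A `&` @values_at R V n us @^-1` [set 0].
Proof.
apply/seteqP; split => f.
  move=> [g Ag <-]; split; first by rewrite /= restrict_zero_ext.
  by apply/rowP => i; rewrite !mxE zero_ext_deleted.
move=> [Af /rowP f0]; exists (restrict us f) => //.
by apply: zero_ext_restrict => i; have := f0 i; rewrite !mxE.
Qed.

Lemma closed_zero_ext (R : realType) (V : finType) n (us : n.-tuple V)
    (A : set {ptws {v : V | v \notin us} -> R}) :
  closed A -> closed (@zero_ext R V n us @` A).
Proof.
move=> clA; rewrite zero_ext_imageE; apply: closedI.
  by apply: preimage_closed => // f _; exact: continuous_restrict.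
apply: preimage_closed => [f _|]; first exact: continuous_values_at.
exact/accessible_closed_set1/hausdorff_accessible/norm_hausdorff.
Qed.

(** * Energy and Rayleigh quotient of an extension by zero *)

Lemma sum_delete_nodes (R : realType) (V : finType) n (us : n.-tuple V)
    (F : V -> R) : uniq us ->
  \sum_v F v =
  \sum_(u : {v : V | v \notin us}) F (val u) + \sum_(i < n) F (tnth us i).
Proof.
move=> uus; rewrite (bigID (fun v => v \in us))/= addrC; congr (_ + _).
  exact: (big_sub [predC us]).
by rewrite -big_uniq// big_tuple.
Qed.

Lemma sum_zero_ext (R : realType) (V : finType) n (us : n.-tuple V) (p : R)
    (c : V -> R) (f : {ptws {v : V | v \notin us} -> R}) :
  uniq us -> p != 0 ->
  \sum_v c v * `|zero_ext f v| `^ p = \sum_u c (val u) * `|f u| `^ p.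
Proof.
move=> uus p0; rewrite (sum_delete_nodes _ uus) [X in _ + X]big1 ?addr0.
  by apply: eq_bigr => u _; rewrite zero_ext_val.
by move=> i _; rewrite zero_ext_deleted normr0 powR0// mulr0.
Qed.

(** The edges between deleted nodes contribute nothing. Each edge joining a
remaining node to a deleted one is met twice in the double sum, which the
factor 1/2 compensates; it gives the term that the reduced operator carries in
kappa. *)
Lemma energy_zero_ext (R : realType) (V : finType) (p : R)
    (H : pLaplacian R V) n (us : n.-tuple V)
    (f : {ptws {v : V | v \notin us} -> R}) :
  uniq us -> p != 0 ->
  energy p H (zero_ext f) = energy p (delete_nodes H us) f.
Proof.
move=> uus p0; rewrite /energy (sum_zero_ext _ _ uus p0).
have full (W : finType) (L : pLaplacian R W) (g : W -> R) :
    \sum_u \sum_(v | adj L u v) edge_weight L u v * `|g u - g v| `^ p =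
    \sum_u \sum_v edge_weight L u v * `|g u - g v| `^ p.
  apply: eq_bigr => u _; rewrite big_mkcond; apply: eq_bigr => v _.
  by case: ifPn => // /edge_weight_eq0->; rewrite mul0r.
rewrite !full {full} [in RHS]/=.
(* the energy of the edges between remaining and deleted nodes *)
pose bd := \sum_(u : {v | v \notin us})
  \sum_(i < n) edge_weight H (val u) (tnth us i) * `|f u| `^ p.
have -> : \sum_u \sum_v edge_weight H u v * `|zero_ext f u - zero_ext f v| `^ p
    = \sum_(u : {v | v \notin us}) \sum_(v : {v | v \notin us})
        edge_weight H (val u) (val v) * `|f u - f v| `^ p + bd + bd.
  rewrite (sum_delete_nodes _ uus); congr (_ + _).
    rewrite /bd -big_split; apply: eq_bigr => u _ /=.
    rewrite (sum_delete_nodes _ uus); congr (_ + _); apply: eq_bigr => v _.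
      by rewrite !zero_ext_val.
    by rewrite zero_ext_val zero_ext_deleted subr0.
  rewrite /bd [RHS]exchange_big; apply: eq_bigr => i _ /=.
  rewrite (sum_delete_nodes _ uus) [X in _ + X]big1 ?addr0.
    apply: eq_bigr => u _; rewrite edge_weight_sym zero_ext_val.
    by rewrite zero_ext_deleted sub0r normrN.
  by move=> j _; rewrite !zero_ext_deleted subr0 normr0 powR0// mulr0.
have -> : \sum_u (kappa H (val u) +
      \sum_(i < n) edge_weight H (val u) (tnth us i)) * `|f u| `^ p =
    \sum_u kappa H (val u) * `|f u| `^ p + bd.
  rewrite /bd -big_split; apply: eq_bigr => u _ /=.
  by rewrite mulrDl mulr_suml.
by field.
Qed.

Lemma rayleigh_zero_ext (R : realType) (V : finType) (p : R)
    (H : pLaplacian R V) n (us : n.-tuple V)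
    (f : {ptws {v : V | v \notin us} -> R}) :
  uniq us -> p != 0 ->
  rayleigh p H (zero_ext f) = rayleigh p (delete_nodes H us) f.
Proof.
by move=> uus p0; rewrite /rayleigh energy_zero_ext// sum_zero_ext.
Qed.

Lemma pnorm_zero_ext (R : realType) (V : finType) (p : R) n
    (us : n.-tuple V) (f : {ptws {v : V | v \notin us} -> R}) :
  uniq us -> p != 0 -> pnorm p (zero_ext f) = pnorm p f.
Proof.
move=> uus p0; have := sum_zero_ext (fun=> 1) f uus p0.
under eq_bigr do rewrite mul1r.
under [RHS]eq_bigr do rewrite mul1r.
by rewrite /pnorm => ->.
Qed.

(** * Transport of the min-max families *)

(** The genus does not decrease along the continuous odd map [zero_ext]. *)
Lemma genus_family_zero_ext_image (R : realType) (V : finType) (p : R) n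
    (us : n.-tuple V) k (A : set {ptws {v : V | v \notin us} -> R}) :
  uniq us -> p != 0 -> genus_family p k A ->
  genus_family p k (@zero_ext R V n us @` A).
Proof.
move=> uus p0 [sA symA clA gA]; split.
- by move=> _ [f Af <-]; rewrite /psphere/= pnorm_zero_ext//; exact: sA.
- have N f : (@zero_ext R V n us @` A) f -> (@zero_ext R V n us @` A) (\- f).
    by move=> [g Ag <-]; exists (\- g); [exact: (symA g).1|rewrite zero_extN].
  move=> f; split=> [/N//|/N].
  by congr (_ _); apply/funext => v /=; rewrite opprK.
- exact: closed_zero_ext.
- apply/genus_geP => j g cg og g0.
  have /genus_geP/(_ j (g \o @zero_ext R V n us)) := gA; apply.
  + apply: within_continuous_comp_image cg.
    exact: continuous_zero_ext.
  + by move=> f Af /=; rewrite zero_extN og//; exists f.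
  + by move=> f Af /=; apply: g0; exists f.
Qed.

(** The n conditions of vanishing at a deleted node lower the genus by at most
n: they are n further coordinates that can be added to an odd map defined on
the part of A where they hold. *)
Lemma genus_family_zero_ext_preimage (R : realType) (V : finType) (p : R) n
    (us : n.-tuple V) k (A : set {ptws V -> R}) :
  uniq us -> p != 0 -> genus_family p (k + n) A ->
  genus_family p k (@zero_ext R V n us @^-1` A).
Proof.
move=> uus p0 [sA symA clA gA].
have symA' : symmetric_set (@zero_ext R V n us @^-1` A).
  by move=> f; rewrite /= zero_extN; exact: symA.
have clA' : closed (@zero_ext R V n us @^-1` A).
  by apply: preimage_closed => // f _; exact: continuous_zero_ext.
split=> //.
  by move=> f /sA; rewrite /psphere/= pnorm_zero_ext.
apply/genus_geP => j g cg og g0.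
have [G [cG oG G0]] := odd_extension clA' symA' cg og g0.
pose G' f := row_mx (G (restrict us f)) (values_at us f).
have /genus_geP/(_ _ G') := gA; rewrite leq_add2r; apply.
- apply: continuous_subspaceT; apply: continuous_mx => a i.
  rewrite /G' => f; case: (splitP i) => i' ii'.
    have -> : i = lshift n i' by exact: val_inj.
    under [X in continuous_at _ X]eq_fun do rewrite row_mxEl.
    apply: (@continuous_comp {ptws V -> R} 'rV[R]_j R
      (G \o @restrict R V n us) (fun M => M a i')); last exact: coord_continuous.
    apply: continuous_comp; last exact: cG.
    exact: continuous_restrict.
  have -> : i = rshift j i' by exact: val_inj.
  under [X in continuous_at _ X]eq_fun do rewrite row_mxEr.
  apply: (@continuous_comp {ptws V -> R} 'rV[R]_n R
    (@values_at R V n us) (fun M => M a i')); last exact: coord_continuous.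
  exact: continuous_values_at.
- move=> f _; rewrite /G' opp_row_mx -oG; congr row_mx.
  by apply/rowP => i; rewrite !mxE.
- move=> f Af; rewrite /G' row_mx_eq0 negb_and orbC.
  have [/rowP f0|//] := eqVneq (values_at us f) 0.
  apply: G0; rewrite /= zero_ext_restrict// => i.
  by have := f0 i; rewrite !mxE.
Qed.

Theorem theorem5p5 (R : realType) (V : finType) (p : R) (hp : 1 < p)
    (H : pLaplacian R V) (n : nat) (us : n.-tuple V) (hus : uniq us)
    (k : nat) (hk : (1 <= k <= #|V| - n)%N) :
  (variational_eigenvalue p H k
     <= variational_eigenvalue p (delete_nodes H us) k)%E /\
  (variational_eigenvalue p (delete_nodes H us) k
     <= variational_eigenvalue p H (k + n))%E.
Proof.
have p0 : p != 0 by rewrite gt_eqF// (lt_trans ltr01).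
split; apply: le_ereal_inf_tmp => _ [A FA <-].
- apply: (@le_trans _ _
    (ereal_sup [set (rayleigh p H f)%:E | f in @zero_ext R V n us @` A])).
    apply: ereal_inf_lbound; eexists=> //.
    exact: genus_family_zero_ext_image FA.
  apply: ereal_sup_le => _ [_ [f Af <-] <-]; exists f => //.
  by rewrite rayleigh_zero_ext.
- apply: (@le_trans _ _ (ereal_sup [set (rayleigh p (delete_nodes H us) f)%:E
    | f in @zero_ext R V n us @^-1` A])).
    apply: ereal_inf_lbound; eexists=> //.
    exact: genus_family_zero_ext_preimage FA.
  apply: ereal_sup_le => _ [f Af <-]; exists (zero_ext f) => //.
  by rewrite rayleigh_zero_ext.
Qed.
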